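(* Let $m,n,l$ be pairwise relatively prime positive integers, where $m=\prod_{i=1}^j p_i$ is a product of pairwise distinct primes $p_i\equiv 1 \pmod 6$, and $m^2=n^2+nl+l^2$. Let $k:=n+l$ and $A:=klmn$. Then the rank of the elliptic curve $C_A: y^2=x^3-A^2x$ over $\mathbb{Q}$ is at least two.
   Context: The rank of $C_A$ means the rank $r$ of the finitely generated abelian group $C_A(\mathbb{Q})$ of rational points of $C_A$ (together with the point at infinity), i.e. $C_A(\mathbb{Q})\cong T\times\mathbb{Z}^r$ with $T$ finite. *)

(* Defs.v *)
From HB Require Import structures.
From mathcomp Require Import all_boot all_order all_algebra.
From mathcomp Require Import ring.
Set Implicit Arguments.
Unset Strict Implicit.
Unset Printing Implicit Defensive.
Import GRing.Theory.
Local Open Scope ring_scope.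

(* Short Weierstrass curves y^2 = x^3 + a x + b. The factor 16 of the
   discriminant is kept so that characteristic 2 is excluded too. *)
Record ellCurve (F : fieldType) := EllCurve {
  ec_a : F;
  ec_b : F;
  ec_disc : - 16%:R * (4%:R * ec_a ^+ 3 + 27%:R * ec_b ^+ 2) != 0
}.

(* None is the point at infinity. *)
Definition on_curve (F : fieldType) (E : ellCurve F) (P : option (F * F)) :=
  if P is Some (x, y) then y ^+ 2 == x ^+ 3 + ec_a E * x + ec_b E else true.

Definition ec_opp (F : fieldType) (P : option (F * F)) : option (F * F) :=
  if P is Some (x, y) then Some (x, - y) else None.

Definition ec_slope (F : fieldType) (E : ellCurve F) (x1 y1 x2 y2 : F) : F :=
  if x1 == x2 then (3%:R * x1 ^+ 2 + ec_a E) / (2%:R * y1)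
  else (y2 - y1) / (x2 - x1).

Definition ec_add (F : fieldType) (E : ellCurve F) (P Q : option (F * F)) :
    option (F * F) :=
  match P, Q with
  | None, _ => Q
  | _, None => P
  | Some (x1, y1), Some (x2, y2) =>
      if (x1 == x2) && (y1 == - y2) then None
      else let s := ec_slope E x1 y1 x2 y2 in
           let x3 := s ^+ 2 - x1 - x2 in
           Some (x3, s * (x1 - x3) - y1)
  end.

(* This section shows that ec_add is an abelian group law. A
   slope s of the line through two points (the tangent if they coincide) is
   handled through the relation slope_of, which covers both cases at once. *)
Section GroupLaw.
Variables (F : fieldType) (E : ellCurve F).
Implicit Types (P Q R : option (F * F)) (x y s : F).
Local Notation a := (ec_a E).
Local Notation b := (ec_b E).
Local Notation add := (ec_add E).
Local Notation opp := (@ec_opp F).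
Local Notation onC := (on_curve E).

Definition slope_of x1 y1 x2 y2 s :=
  y2 - y1 = s * (x2 - x1) /\
  s * (y1 + y2) = x1 ^+ 2 + x1 * x2 + x2 ^+ 2 + a.

Definition sum_with x1 y1 x2 s : option (F * F) :=
  Some (s ^+ 2 - x1 - x2, s * (x1 - (s ^+ 2 - x1 - x2)) - y1).

Lemma ec_two_neq0 : 2%:R != 0 :> F.
Proof.
apply: contraNneq (ec_disc E) => h2.
by rewrite (natrM _ 2 8) h2 mul0r oppr0 mul0r.
Qed.

Lemma ec_nonsingular x : x ^+ 3 + a * x + b = 0 -> 3%:R * x ^+ 2 + a != 0.
Proof.
move=> h1; apply: contraNneq (ec_disc E) => h2.
have ea : a = - (3%:R * x ^+ 2) by rewrite -(addKr (3%:R * x ^+ 2) a) h2 addr0.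
have eb : b = 2%:R * x ^+ 3.
  have -> : b = x ^+ 3 + a * x + b - x ^+ 3 - a * x by ring.
  by rewrite h1 ea; ring.
by rewrite ea eb; apply/eqP; ring.
Qed.

Lemma ec_slope_uniq x1 y1 x2 y2 s t :
  slope_of x1 y1 x2 y2 s -> slope_of x1 y1 x2 y2 t ->
  ~~ ((x1 == x2) && (y1 == - y2)) -> s = t.
Proof.
case=> [s1 s2] [t1 t2]; case: eqVneq => [e|ne] /=.
  by rewrite -addr_eq0 => n0; apply: (mulIf n0); rewrite s2.
by move=> _; apply: (mulIf (_ : x2 - x1 != 0)); rewrite ?subr_eq0 1?eq_sym // -s1.
Qed.

Lemma ec_slopeP x1 y1 x2 y2 :
  onC (Some (x1, y1)) -> onC (Some (x2, y2)) ->
  ~~ ((x1 == x2) && (y1 == - y2)) ->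
  slope_of x1 y1 x2 y2 (ec_slope E x1 y1 x2 y2).
Proof.
move=> /eqP o1 /eqP o2; rewrite /ec_slope /slope_of; case: eqVneq => [e|ne] /=.
  move=> n0.
  have /eqP : (y1 - y2) * (y1 + y2) = 0.
    by rewrite -subr_sqr o1 o2 e subrr.
  rewrite mulf_eq0 subr_eq0 addr_eq0 (negPf n0) orbF => /eqP ey.
  rewrite -ey -e !subrr mulr0; split=> //.
  have y0 : y1 != 0 by apply: contraNneq n0 => h; rewrite -ey h oppr0.
  by field; rewrite ?y0 ?ec_two_neq0.
have n1 : x2 - x1 != 0 by rewrite subr_eq0 eq_sym.
move=> _; split; first by rewrite divfK.
apply: (mulIf n1); rewrite mulrAC divfK // [y1 + y2]addrC -subr_sqr o1 o2; ring.
Qed.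

Lemma ec_add_slope x1 y1 x2 y2 s :
  onC (Some (x1, y1)) -> onC (Some (x2, y2)) ->
  ~~ ((x1 == x2) && (y1 == - y2)) -> slope_of x1 y1 x2 y2 s ->
  add (Some (x1, y1)) (Some (x2, y2)) = sum_with x1 y1 x2 s.
Proof.
move=> o1 o2 n0 hs; rewrite /= (negPf n0).
by rewrite (ec_slope_uniq (ec_slopeP o1 o2 n0) hs n0).
Qed.

Lemma add_spec x1 y1 x2 y2 :
  onC (Some (x1, y1)) -> onC (Some (x2, y2)) ->
  [/\ x1 = x2, y1 = - y2 & add (Some (x1, y1)) (Some (x2, y2)) = None] \/
  exists s, [/\ slope_of x1 y1 x2 y2 s, ~~ ((x1 == x2) && (y1 == - y2)) &
    add (Some (x1, y1)) (Some (x2, y2)) = sum_with x1 y1 x2 s].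
Proof.
move=> o1 o2; case: (boolP ((x1 == x2) && (y1 == - y2))) => [h|h].
  by left; case/andP: (h) => /eqP e1 /eqP e2; split=> //; rewrite /= h.
right; exists (ec_slope E x1 y1 x2 y2); split=> //; first exact: ec_slopeP.
by apply: ec_add_slope => //; apply: ec_slopeP.
Qed.

Lemma slope_a x1 y1 x2 y2 s : slope_of x1 y1 x2 y2 s ->
  y1 = y2 + s * (x1 - x2) /\
  a = s * (2%:R * y2 + s * (x1 - x2)) - (x1 ^+ 2 + x1 * x2 + x2 ^+ 2).
Proof.
case=> [h1 h2].
have ey : y1 = y2 + s * (x1 - x2).
  by rewrite -[y1](subKr y2) h1; ring.
split=> //; rewrite -[a](addKr (x1 ^+ 2 + x1 * x2 + x2 ^+ 2)) -h2 ey; ring.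
Qed.

Lemma on_curve_opp P : onC (opp P) = onC P.
Proof. by case: P => [[x y]|] //=; rewrite sqrrN. Qed.

Lemma on_curve_add P Q : onC P -> onC Q -> onC (add P Q).
Proof.
case: P => [[x1 y1]|] // o1; case: Q => [[x2 y2]|] // o2.
case: (add_spec o1 o2) => [[_ _ ->] //|[s [hs _ ->]]].
have [e1 ea] := slope_a hs.
have eb : b = y2 ^+ 2 - x2 ^+ 3 - a * x2 by rewrite (eqP o2); ring.
by apply/eqP; rewrite eb ea e1; ring.
Qed.

Lemma ec_addC P Q : onC P -> onC Q -> add P Q = add Q P.
Proof.
case: P => [[x1 y1]|]; case: Q => [[x2 y2]|] // o1 o2.
case: (add_spec o1 o2) => [[e1 e2 ->]|[s [[h1 h2] n0 ->]]].
  by rewrite /= e1 e2 opprK !eqxx.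
have hs : slope_of x2 y2 x1 y1 s.
  by split; [rewrite -(opprB y2) h1; ring | rewrite addrC h2; ring].
rewrite (ec_add_slope o2 o1 _ hs).
  have [e1 _] := slope_a (conj h1 h2).
  by rewrite /sum_with e1; congr (Some (_, _)); ring.
by rewrite eq_sym [y2 == _]eq_sym eqr_oppLR.
Qed.

Lemma ec_oppK P : opp (opp P) = P.
Proof. by case: P => [[x y]|] //=; rewrite opprK. Qed.

Lemma ec_addNr P : add P (opp P) = None.
Proof. by case: P => [[x y]|] //=; rewrite opprK !eqxx. Qed.

Lemma ec_addr0 P : add P None = P.
Proof. by case: P => [[]|]. Qed.

Lemma ec_addK P Q : onC P -> onC Q -> add (add P Q) (opp Q) = P.
Proof.
case: Q => [[x2 y2]|]; last by rewrite !ec_addr0.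
case: P => [[x1 y1]|] o1 o2; last exact: ec_addNr.
case: (add_spec o1 o2) => [[-> -> ->] //|[s [hs n0 e]]].
have o3 := on_curve_add o1 o2; rewrite e /sum_with in o3 *.
have o2' : onC (Some (x2, - y2)) by rewrite -(on_curve_opp (Some (x2, y2))) in o2.
have [e1 ea] := slope_a hs.
move: o3; move ex3 : (s ^+ 2 - x1 - x2) => x3 o3.
have hs' : slope_of x3 (s * (x1 - x3) - y1) x2 (- y2) (- s).
  by split; rewrite ?ea e1 -ex3; ring.
rewrite (ec_add_slope o3 o2' _ hs').
  by rewrite /sum_with e1 -ex3; congr (Some (_, _)); ring.
rewrite opprK; apply/negP => /andP[/eqP ex /eqP ey].
have y0 : y2 = 0.
  have : 2%:R * y2 = 0.
    have -> : 2%:R * y2 = y2 - (s * (x1 - x3) - y1) - s * (x3 - x2).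
      by rewrite e1; ring.
    by rewrite ey ex; ring.
  by move/eqP; rewrite mulf_eq0 (negPf ec_two_neq0) => /eqP.
have /ec_nonsingular/eqP[] : x2 ^+ 3 + a * x2 + b = 0.
  by rewrite -(eqP o2) y0 expr0n.
have ex1 : s ^+ 2 = x1 + 2%:R * x2.
  have -> : s ^+ 2 = x3 + x1 + x2 by rewrite -ex3; ring.
  by rewrite ex; ring.
by rewrite ea y0; transitivity (s ^+ 2 * (x1 - x2) - (x1 - x2) * (x1 + 2%:R * x2));
  [ring | rewrite ex1; ring].
Qed.

Lemma slopes_solve (u1 us u3 ut la mu w : F) : la != mu ->
  la ^+ 2 - u1 - us = mu ^+ 2 - u3 - ut ->
  u1 * us + w * la = u3 * ut + w * mu ->
  ut = mu ^+ 2 - u3 - (la ^+ 2 - u1 - us) /\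
  w = (u3 * ut - u1 * us) / (la - mu).
Proof.
rewrite -subr_eq0 => n1 eut ew; split; first by rewrite eut; ring.
by apply: (mulIf n1); rewrite divfK // mulrBr -(addKr (u1 * us) (w * la)) ew; ring.
Qed.

(* In the next three lemmas the x-coordinates are taken relative to that of
   the middle point Q, w is twice the y-coordinate of Q, and u1, us, u3, ut are
   those of P, P + Q, R, Q + R; la, mu, nu, rho are the slopes for (P, Q),
   (Q, R), (P + Q, R) and (P, Q + R). *)
Lemma assoc_generic (u1 us u3 ut la mu w nu rho : F) :
  la != mu -> us != u3 -> ut != u1 ->
  la ^+ 2 - u1 - us = mu ^+ 2 - u3 - ut ->
  u1 * us + w * la = u3 * ut + w * mu ->
  nu * (us - u3) = - (w + la * us + mu * u3) ->
  rho * (ut - u1) = - (w + mu * ut + la * u1) ->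
  let uf := nu ^+ 2 - us - u3 - (la ^+ 2 - u1 - us) in
  nu ^+ 2 - us - u3 = rho ^+ 2 - u1 - ut /\
  nu * (u3 - uf) - mu * u3 = rho * (u1 - uf) - la * u1.
Proof.
move=> n1; rewrite -(subr_eq0 us) -(subr_eq0 ut) => n2 n3 eut ew enu erho uf.
have [eut' ew'] := slopes_solve n1 eut ew; rewrite -subr_eq0 in n1.
have enu' : nu = - (w + la * us + mu * u3) / (us - u3).
  by apply: (mulIf n2); rewrite divfK.
have erho' : rho = - (w + mu * ut + la * u1) / (ut - u1).
  by apply: (mulIf n3); rewrite divfK.
have n3' : mu ^+ 2 - u3 - (la ^+ 2 - u1 - us) - u1 != 0 by rewrite -eut'.
by rewrite /uf enu' erho' ew' eut'; split; field; rewrite ?n1 ?n2 ?n3'.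
Qed.

Lemma assoc_tangent (u1 us u3 ut la mu w nu rho : F) :
  la != mu -> us = u3 -> ut != u1 -> mu * u3 - la * us != 0 ->
  la ^+ 2 - u1 - us = mu ^+ 2 - u3 - ut ->
  u1 * us + w * la = u3 * ut + w * mu ->
  nu * (us - u3) = - (w + la * us + mu * u3) ->
  nu * (mu * u3 - la * us) = us ^+ 2 + us * u3 + u3 ^+ 2
     + (la ^+ 2 - u1 - us) * (us + u3) + (u1 * us + w * la) ->
  rho * (ut - u1) = - (w + mu * ut + la * u1) ->
  let uf := nu ^+ 2 - us - u3 - (la ^+ 2 - u1 - us) in
  nu ^+ 2 - us - u3 = rho ^+ 2 - u1 - ut /\
  nu * (u3 - uf) - mu * u3 = rho * (u1 - uf) - la * u1.
Proof.
move=> n1 e3; rewrite -e3 -(subr_eq0 ut) => n3; rewrite -mulrBl mulf_eq0 negb_or.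
case/andP=> n1' us0 eut _ ew enu erho uf.
have eut' : ut = mu ^+ 2 - us - (la ^+ 2 - u1 - us) by rewrite eut; ring.
have ew' : w = - (la + mu) * us.
  have -> : w = w + la * us + mu * us - (la + mu) * us by ring.
  by rewrite -[X in X - _]opprK -ew subrr mulr0 oppr0 add0r mulNr.
have enu' : nu = (us ^+ 2 + us * us + us ^+ 2
     + (la ^+ 2 - u1 - us) * (us + us) + (u1 * us + w * la)) / ((mu - la) * us).
  by apply: (mulIf (mulf_neq0 n1' us0)); rewrite divfK ?mulf_neq0.
have erho' : rho = - (w + mu * ut + la * u1) / (ut - u1).
  by apply: (mulIf n3); rewrite divfK.
have eut1 : ut - u1 = (mu - la) * (mu + la) by rewrite eut'; ring.
have : mu + la != 0 by apply: contraNneq n3 => h; rewrite eut1 h mulr0.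
move=> n4; rewrite eut1 in erho'.
by rewrite /uf enu' erho' ew' eut'; split; field; rewrite ?n1' ?us0 ?n4.
Qed.

Lemma assoc_tangents (u1 us u3 ut la mu w nu rho : F) :
  la != mu -> us = u3 -> ut = u1 ->
  mu * u3 - la * us != 0 -> la * u1 - mu * ut != 0 ->
  la ^+ 2 - u1 - us = mu ^+ 2 - u3 - ut ->
  nu * (us - u3) = - (w + la * us + mu * u3) ->
  nu * (mu * u3 - la * us) = us ^+ 2 + us * u3 + u3 ^+ 2
     + (la ^+ 2 - u1 - us) * (us + u3) + (u1 * us + w * la) ->
  rho * (la * u1 - mu * ut) = ut ^+ 2 + ut * u1 + u1 ^+ 2
     + (la ^+ 2 - u1 - us) * (ut + u1) + (u1 * us + w * la) ->
  let uf := nu ^+ 2 - us - u3 - (la ^+ 2 - u1 - us) in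
  nu ^+ 2 - us - u3 = rho ^+ 2 - u1 - ut /\
  nu * (u3 - uf) - mu * u3 = rho * (u1 - uf) - la * u1.
Proof.
move=> n1 e3 e1; rewrite -e3 e1 -!mulrBl !mulf_eq0 !negb_or.
case/andP=> _ us0 /andP[_ u10] eut ew enu erho uf.
have emu : mu = - la.
  have : (la - mu) * (la + mu) = 0.
    rewrite -subr_sqr.
    have -> : la ^+ 2 = la ^+ 2 - u1 - us + u1 + us by ring.
    by rewrite eut; ring.
  move/eqP; rewrite mulf_eq0 subr_eq0 (negPf n1) /= addrC addr_eq0.
  by move/eqP.
have la0 : la != 0 by apply: contraNneq n1 => h; rewrite emu h oppr0.
have ew' : w = 0.
  have -> : w = w + la * us + mu * us by rewrite emu; ring.
  by rewrite -[LHS]opprK -ew subrr mulr0 oppr0.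
have n2 := ec_two_neq0.
have n3 : mu - la != 0 by rewrite subr_eq0 eq_sym.
have enu' : nu = (us ^+ 2 + us * us + us ^+ 2
     + (la ^+ 2 - u1 - us) * (us + us) + (u1 * us + w * la)) / ((mu - la) * us).
  by apply: (mulIf (mulf_neq0 n3 us0)); rewrite divfK ?mulf_neq0.
have n4 : la - mu != 0 by rewrite subr_eq0.
have erho' : rho = (u1 ^+ 2 + u1 * u1 + u1 ^+ 2
     + (la ^+ 2 - u1 - us) * (u1 + u1) + (u1 * us + w * la)) / ((la - mu) * u1).
  by apply: (mulIf (mulf_neq0 n4 u10)); rewrite divfK ?mulf_neq0.
have em : mu - la = - (2%:R * la) by rewrite emu; ring.
have em' : la - mu = 2%:R * la by rewrite emu; ring.
rewrite em in enu'; rewrite em' in erho'.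
by rewrite /uf enu' erho' ew' emu; split; field; rewrite ?oppr_eq0 ?mulf_neq0 ?us0 ?u10 ?n2 ?la0.
Qed.

Lemma ec_oppD P Q : onC P -> onC Q -> opp (add P Q) = add (opp P) (opp Q).
Proof.
case: P => [[x1 y1]|]; case: Q => [[x2 y2]|] // o1 o2.
have o1' : onC (opp (Some (x1, y1))) by rewrite on_curve_opp.
have o2' : onC (opp (Some (x2, y2))) by rewrite on_curve_opp.
case: (add_spec o1 o2) => [[e1 e2 ->]|[s [[h1 h2] n0 ->]]].
  by rewrite /= e1 e2 opprK !eqxx.
rewrite (ec_add_slope o1' o2' _ (_ : slope_of _ _ _ _ (- s))).
- by rewrite /sum_with /=; congr (Some (_, _)); ring.
- by rewrite eqr_opp.
by split; [rewrite mulNr -h1; ring | rewrite -h2; ring].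
Qed.

Lemma add_third P Q : onC P -> onC Q -> add Q (opp (add P Q)) = opp P.
Proof.
move=> o1 o2; have oA := on_curve_add o1 o2.
have oN R : onC R -> onC (opp R) by rewrite on_curve_opp.
rewrite -[in RHS](ec_addK o1 o2) [RHS]ec_oppD ?oN // ec_oppK.
by rewrite ec_addC ?oN.
Qed.

Lemma ec_addA P Q R : onC P -> onC Q -> onC R ->
  add P (add Q R) = add (add P Q) R.
Proof.
move=> oP oQ oR; have oN S : onC S -> onC (opp S) by rewrite on_curve_opp.
have oPQ := on_curve_add oP oQ; have oQR := on_curve_add oQ oR.
have third1 : R = opp (add P Q) -> add P (add Q R) = add (add P Q) R.
  by move=> ->; rewrite add_third // !ec_addNr.
have third2 : P = opp (add Q R) -> add P (add Q R) = add (add P Q) R.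
  move=> eP; rewrite (ec_addC oP oQ) eP [add Q R]ec_addC // add_third //.
  by rewrite [LHS]ec_addC ?oN ?on_curve_add // [RHS]ec_addC ?oN // !ec_addNr.
case: P oP oPQ third1 third2 => [[x1 y1]|] // oP oPQ third1 third2.
case: Q oQ oPQ oQR third1 third2 => [[x2 y2]|] // oQ oPQ oQR third1 third2.
case: R oR oQR third1 third2 => [[x3 y3]|] // oR oQR third1 third2; last first.
  by rewrite !ec_addr0.
case: (add_spec oP oQ) => [[e1 e2 e]|[la [hla n0 ela]]].
  rewrite e e1 e2 -[Some (x2, - y2)]/(opp (Some (x2, y2))).
  by rewrite [add _ (Some (x3, _))]ec_addC // ec_addC ?oN ?on_curve_add // ec_addK.
case: (add_spec oQ oR) => [[e1 e2 e]|[mu [hmu n0' emu]]].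
  rewrite e ec_addr0; have -> : Some (x3, y3) = opp (Some (x2, y2)).
    by rewrite /= e1 e2 opprK.
  by rewrite ec_addK.
have [ey1 ea1] := slope_a hla.
have [ey3' ea3'] := slope_a hmu.
have ey3 : y3 = y2 + mu * (x3 - x2) by rewrite ey3'; ring.
have ea3 : a = mu * (2%:R * y2 + mu * (x3 - x2)) - (x2 ^+ 2 + x2 * x3 + x3 ^+ 2).
  by rewrite [LHS]ea3' ey3; ring.
move: oPQ oQR third1 third2; rewrite ela emu /sum_with.
move exs : (la ^+ 2 - x1 - x2) => xs; move ext : (mu ^+ 2 - x2 - x3) => xt.
move eys : (la * (x1 - xs) - y1) => ys; move eyt : (mu * (x2 - xt) - y2) => yt.
move=> oPQ oQR third1 third2.
have rel1 : la ^+ 2 - (x1 - x2) - (xs - x2) = mu ^+ 2 - (x3 - x2) - (xt - x2).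
  by rewrite -exs -ext; ring.
have rel2a : (x1 - x2) * (xs - x2) + 2%:R * y2 * la = 3%:R * x2 ^+ 2 + a.
  by rewrite ea1 -exs; ring.
have rel2b : (x3 - x2) * (xt - x2) + 2%:R * y2 * mu = 3%:R * x2 ^+ 2 + a.
  by rewrite ea3 -ext; ring.
case: (eqVneq la mu) => [elm|nlm].
  have : (x3 - x1) * (x3 - xs) = 0.
    have -> : (x3 - x1) * (x3 - xs) = ((x1 - x2) * (xs - x2) + 2%:R * y2 * la)
       - 2%:R * y2 * la + (x3 - x2) * ((la ^+ 2 - (x1 - x2) - (xs - x2))
         - la ^+ 2 + (x3 - x2)) by ring.
    by rewrite rel2a -rel2b rel1 elm; ring.
  move/eqP; rewrite mulf_eq0 !subr_eq0 => /orP[]/eqP ex.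
    have ey : y3 = y1 by rewrite ey3 ey1 ex elm.
    have eR : Some (x3, y3) = Some (x1, y1) by rewrite ex ey.
    rewrite eR [RHS]ec_addC //; congr (add _ _).
    rewrite -(_ : add (Some (x2, y2)) (Some (x3, y3)) = Some (xt, yt)); last first.
      by rewrite emu /sum_with ext eyt.
    rewrite eR ec_addC // ela /sum_with exs eys //.
  apply: third1; rewrite /= -ex; congr (Some (_, _)).
  by rewrite -eys ey1 ey3 -ex elm; ring.
case: (add_spec oPQ oR) => [[e1 e2 _]|[nu [hnu n1 enu]]].
  by apply: third1; rewrite /= e1 e2 opprK.
case: (add_spec oP oQR) => [[e1 e2 _]|[rho [hrho n2 erho]]].
  by apply: third2; rewrite /= e1 e2.
rewrite enu erho.
set uf := nu ^+ 2 - (xs - x2) - (x3 - x2)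
           - (la ^+ 2 - (x1 - x2) - (xs - x2)).
suff [h1 h2] :
   nu ^+ 2 - (xs - x2) - (x3 - x2) = rho ^+ 2 - (x1 - x2) - (xt - x2) /\
   nu * ((x3 - x2) - uf) - mu * (x3 - x2) = rho * ((x1 - x2) - uf) - la * (x1 - x2).
  have ex : rho ^+ 2 - x1 - xt = nu ^+ 2 - xs - x3.
    transitivity (rho ^+ 2 - (x1 - x2) - (xt - x2) - 2%:R * x2); first by ring.
    by rewrite -h1; ring.
  have euf : nu ^+ 2 - xs - x3 = uf + x2 by rewrite /uf -exs; ring.
  rewrite /sum_with ex euf; congr (Some (_, _)).
  transitivity (rho * (x1 - x2 - uf) - la * (x1 - x2) - y2); first by rewrite ey1; ring.
  rewrite -h2.
  have [eys' _] := slope_a hnu.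
  by rewrite eys' ey3; ring.
have rel2 := etrans rel2a (esym rel2b).
have nu1 : nu * ((xs - x2) - (x3 - x2)) =
   - (2%:R * y2 + la * (xs - x2) + mu * (x3 - x2)).
  transitivity (- (y3 - ys)); first by rewrite (hnu.1); ring.
  by rewrite ey3 -eys ey1; ring.
have rho1 : rho * ((xt - x2) - (x1 - x2)) =
   - (2%:R * y2 + mu * (xt - x2) + la * (x1 - x2)).
  transitivity (yt - y1); first by rewrite (hrho.1); ring.
  by rewrite -eyt ey1; ring.
have nu2 : nu * (mu * (x3 - x2) - la * (xs - x2)) =
   (xs - x2) ^+ 2 + (xs - x2) * (x3 - x2) + (x3 - x2) ^+ 2
     + (la ^+ 2 - (x1 - x2) - (xs - x2)) * ((xs - x2) + (x3 - x2))
     + ((x1 - x2) * (xs - x2) + 2%:R * y2 * la).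
  transitivity (nu * (ys + y3)); first by rewrite -eys ey3 ey1; ring.
  by rewrite (hnu.2) rel2a -exs; ring.
have rho2 : rho * (la * (x1 - x2) - mu * (xt - x2)) =
   (xt - x2) ^+ 2 + (xt - x2) * (x1 - x2) + (x1 - x2) ^+ 2
     + (la ^+ 2 - (x1 - x2) - (xs - x2)) * ((xt - x2) + (x1 - x2))
     + ((x1 - x2) * (xs - x2) + 2%:R * y2 * la).
  transitivity (rho * (y1 + yt)); first by rewrite -eyt ey1; ring.
  by rewrite (hrho.2) rel2a -exs; ring.
have d1 : xs = x3 -> mu * (x3 - x2) - la * (xs - x2) != 0.
  move=> e; move: n1; rewrite e eqxx /= -addr_eq0; apply: contraNneq => h.
  by rewrite -h -eys ey3 ey1 e; apply/eqP; ring.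
have d2 : xt = x1 -> la * (x1 - x2) - mu * (xt - x2) != 0.
  move=> e; move: n2; rewrite e eqxx /= -addr_eq0; apply: contraNneq => h.
  by rewrite -h -eyt ey1 e; apply/eqP; ring.
have sI (z t : F) : z - x2 = t - x2 -> z = t by move/addIr.
case: (eqVneq (xs - x2) (x3 - x2)) => e1; case: (eqVneq (xt - x2) (x1 - x2)) => e2.
- exact: (assoc_tangents nlm e1 e2 (d1 (sI _ _ e1)) (d2 (sI _ _ e2)) rel1 nu1 nu2 rho2).
- exact: (assoc_tangent nlm e1 e2 (d1 (sI _ _ e1)) rel1 rel2 nu1 nu2 rho1).
- rewrite eq_sym in nlm; rewrite rel2 in rho2; rewrite rel1 in rho2.
  have [h1 h2] := assoc_tangent nlm e2 e1 (d2 (sI _ _ e2)) (esym rel1) (esym rel2)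
    rho1 rho2 nu1.
  by rewrite /uf rel1 [nu ^+ 2 - _ - _]addrAC -h1; split; [ring | exact/esym].
- exact: (assoc_generic nlm e1 e2 rel1 rel2 nu1 rho1).
Qed.

End GroupLaw.

Record ec_point (F : fieldType) (E : ellCurve F) := EcPoint {
  ec_coord :> option (F * F);
  ec_coordP : on_curve E ec_coord
}.

HB.instance Definition _ (F : fieldType) (E : ellCurve F) :=
  [isSub for @ec_coord F E].
HB.instance Definition _ (F : fieldType) (E : ellCurve F) :=
  [Choice of ec_point E by <:].

Section PointGroup.
Variables (F : fieldType) (E : ellCurve F).

Definition ecp_zero : ec_point E := EcPoint (isT : on_curve E None).
Definition ecp_opp (P : ec_point E) : ec_point E :=
  EcPoint (etrans (on_curve_opp E P) (ec_coordP P)).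
Definition ecp_add (P Q : ec_point E) : ec_point E :=
  EcPoint (on_curve_add (ec_coordP P) (ec_coordP Q)).

Lemma ecp_addA : associative ecp_add.
Proof. by move=> P Q R; apply: val_inj; apply: ec_addA; apply: ec_coordP. Qed.

Lemma ecp_addC : commutative ecp_add.
Proof. by move=> P Q; apply: val_inj; apply: ec_addC; apply: ec_coordP. Qed.

Lemma ecp_add0 : left_id ecp_zero ecp_add.
Proof. by move=> P; apply: val_inj. Qed.

Lemma ecp_addN : left_inverse ecp_zero ecp_opp ecp_add.
Proof.
by move=> P; rewrite ecp_addC; apply: val_inj; apply: ec_addNr.
Qed.

HB.instance Definition _ :=
  GRing.isZmodule.Build (ec_point E) ecp_addA ecp_addC ecp_add0 ecp_addN.

End PointGroup.

Lemma congruent_disc (A : nat) : (0 < A)%N ->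
  - 16%:R * (4%:R * (- A%:R ^+ 2) ^+ 3 + 27%:R * 0 ^+ 2) != 0 :> rat.
Proof.
move=> A_gt0; rewrite expr0n mulr0 addr0.
by rewrite !(mulf_eq0, oppr_eq0, expf_eq0) /= !Num.Theory.pnatr_eq0 (gtn_eqF A_gt0).
Qed.

(* The curve C_A : y^2 = x^3 - A^2 x over the rationals. *)
Definition congruent_curve (A : nat) (A_gt0 : (0 < A)%N) : ellCurve rat :=
  @EllCurve rat (- A%:R ^+ 2) 0 (congruent_disc A_gt0).
Arguments congruent_curve A A_gt0 : clear implicits.

(* G is isomorphic to T x Z^r with T finite. *)
Definition has_rank (G : zmodType) (r : nat) : Prop :=
  exists (T : finZmodType) (f : {additive G -> T * 'rV[int]_r}), bijective f.

Lemma klmn_gt0 (m n l : nat) :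
  (0 < m)%N -> (0 < n)%N -> (0 < l)%N -> (0 < (n + l) * l * m * n)%N.
Proof. by move=> m0 n0 l0; rewrite !muln_gt0 addn_gt0 m0 n0 l0. Qed.

(* Main.v *)
(** If [A = u v (u^2 - v^2)], the right triangle with legs [u^2 - v^2] and
    [2 u v] gives the point with [x = u^2 (u^2 - v^2)] on [C_A].  Since
    [m^2 - n^2 = k l], [m^2 - l^2 = k n] and [k^2 - m^2 = n l], the pairs
    [(m, n)], [(m, l)], [(k, m)] give three such points; they lie on a line of
    slope [k^2], hence sum to zero.  [C_A] has no rational point of order 4, so
    if the rank were at most one, linear algebra over [F_2] would make one of
    these three points a double up to a 2-torsion point.  As [x], [x - A] and
    [x + A] are squares at a double, either [u (u + v)] and [u (u - v)] or
    [u v] would then be squares; by coprimality so is [u], together with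
    [u - v] and [u + v] or with [v].  Hence [m] is a square, against
    squarefreeness, or [k - m], [k], [k + m] are all squares with [m] odd,
    impossible modulo 4. *)
Require Import Defs.
From mathcomp Require Import all_boot all_order all_algebra.
From mathcomp Require Import fingroup ring lra zify.

Set Implicit Arguments.
Unset Strict Implicit.
Unset Printing Implicit Defensive.

Import Order.TTheory GRing.Theory Num.Theory.

Definition is_power (R : pzSemiRingType) (k : nat) (x : R) : Prop :=
  exists y : R, x = (y ^+ k)%R.

Lemma is_power_mulXr (F : fieldType) (k : nat) (x y : F) :
  (y != 0)%R -> is_power k (x * y ^+ k)%R -> is_power k x.
Proof.
move=> y_neq0 [z xyE]; exists (z / y)%R.
by rewrite expr_div_n -xyE mulfK // expf_neq0.
Qed.

Lemma is_power_natr_rat (k N : nat) : is_power k (N%:R : rat)%R -> is_power k N.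
Proof.
case=> q NE; exists `|numq q|.
have eq_int : (N%:Z * denq q ^+ k = numq q ^+ k)%R.
  apply: (@intr_inj rat); rewrite rmorphM !rmorphXn /= -pmulrn NE.
  by rewrite -exprMn -{1}(divq_num_den q) divfK // intr_eq0 denq_neq0.
have eq_nat : N * `|denq q| ^ k = `|numq q| ^ k.
  by move/(congr1 absz): eq_int; rewrite abszM !abszX.
have : coprime (`|numq q| ^ k) (`|denq q| ^ k).
  by rewrite coprimeXl ?coprimeXr ?coprime_num_den.
rewrite -eq_nat coprimeMl => /andP[_].
by rewrite /coprime gcdnn natrXE -eq_nat => /eqP ->; rewrite muln1.
Qed.

Lemma is_power_coprime_mull (k a b : nat) :
  coprime a b -> is_power k (a * b)%N -> is_power k a.
Proof.
case: k => [|k] co_ab [s]; rewrite natrXE => abE.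
  by exists 0; apply/eqP; move/eqP: abE; rewrite muln_eq1 => /andP[].
have [->|a_gt0] := posnP a; first by exists 0; rewrite natrXE exp0n.
set d := gcdn a s; have d_gt0 : 0 < d by rewrite gcdn_gt0 a_gt0.
have [a' aE] := dvdnP (dvdn_gcdl a s : d %| a).
have [s' sE] := dvdnP (dvdn_gcdr a s : d %| s).
have co_as' : coprime a' s'.
  by rewrite /coprime -(eqn_pmul2r d_gt0) mul1n muln_gcdl -aE -sE -/d.
have a'bE : a' * b = s' ^ k.+1 * d ^ k.
  apply/eqP; rewrite -(eqn_pmul2r d_gt0) mulnAC -aE abE sE expnMn.
  by rewrite -mulnA -expnSr.
suff a'_eq : a' = d ^ k by exists d; rewrite natrXE aE a'_eq -expnSr.
apply/eqP; rewrite eqn_dvd; apply/andP; split.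
  by rewrite -(Gauss_dvdr _ (coprimeXr k.+1 co_as')) -a'bE dvdn_mulr.
have co_db : coprime (d ^ k) b.
  by apply/coprimeXl/(coprime_dvdl (dvdn_gcdl a s) co_ab).
by rewrite -(Gauss_dvdl _ co_db) a'bE dvdn_mull.
Qed.

Lemma is_power_coprime_mul_rat (k a b : nat) (c : rat) :
    coprime a b -> c != 0%R -> is_power k ((a * b)%:R * c ^+ k)%R ->
  is_power k a /\ is_power k b.
Proof.
move=> co_ab c_neq0 /(is_power_mulXr c_neq0)/is_power_natr_rat ab_pow; split.
  exact: is_power_coprime_mull ab_pow.
by apply: (@is_power_coprime_mull _ _ a); rewrite 1?coprime_sym 1?mulnC.
Qed.

Lemma coprimenB (a b : nat) : b <= a -> coprime a (a - b) = coprime a b.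
Proof.
move=> le_ba; rewrite coprime_sym -{2}(subnK le_ba) -{3}(subnK le_ba).
by rewrite /coprime gcdnDl [in RHS]gcdnC gcdnDr gcdnC.
Qed.

Lemma logn_prod_distinct_primes (I : finType) (p : I -> nat) (i : I) :
  (forall i, prime (p i)) -> injective p -> logn (p i) (\prod_i p i) = 1.
Proof.
move=> p_prime p_inj.
have rest_gt0 : 0 < \prod_(h | h != i) p h.
  by apply: prodn_cond_gt0 => h _; apply: prime_gt0.
rewrite (bigD1 i) //= (lognM _ (prime_gt0 (p_prime i)) rest_gt0).
rewrite logn_prime // eqxx logn_coprime //.
apply: (big_ind (coprime (p i))) => [|a b co_a co_b|h h_neq].
- exact: coprimen1.
- by rewrite coprimeMr co_a.
- by rewrite prime_coprime // dvdn_prime2 // inj_eq // eq_sym.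
Qed.

Lemma prod_distinct_primes_not_power (I : finType) (p : I -> nat) (k : nat) :
    (forall i, prime (p i)) -> injective p -> 1 < k -> 1 < \prod_i p i ->
  ~ is_power k (\prod_i p i)%N.
Proof.
move=> p_prime p_inj k_gt1 prod_gt1 [s prodE].
have [i _|I_empty] := pickP (fun _ : I => true); last first.
  by rewrite big_pred0 in prod_gt1.
have := logn_prod_distinct_primes i p_prime p_inj.
rewrite prodE natrXE lognX => /eqP; rewrite muln_eq1 => /andP[/eqP k1 _].
by rewrite k1 in k_gt1.
Qed.

Lemma sqrn_mod4 (s : nat) : s ^ 2 %% 4 = odd s.
Proof.
rewrite -{1}(odd_double_half s); set h := s./2.
have -> : (odd s + h.*2) ^ 2 = (h ^ 2 + odd s * h) * 4 + odd s.
  by case: (odd s) => /=; nia.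
by rewrite modnMDl; case: (odd s).
Qed.

Lemma dvdn4_square_progression (x d : nat) :
    d <= x -> is_power 2 (x - d)%N -> is_power 2 x -> is_power 2 (x + d)%N ->
  4 %| d.
Proof.
move=> le_dx [a aE] [b bE] [c cE].
have := (sqrn_mod4 a, sqrn_mod4 b, sqrn_mod4 c).
rewrite -!natrXE -aE -bE -cE => -[[]].
by case: (odd a); case: (odd b); case: (odd c); lia.
Qed.

Section RankModPrime.
Local Open Scope ring_scope.

Lemma intmx_rows_dependent_mod (p r q : nat) (M : 'M[int]_(q, r)) :
    prime p -> (r < q)%N ->
  exists2 c : 'rV['F_p]_q, c != 0 &
    exists v, \sum_i row i M *+ c 0 i = v *+ p.
Proof.
move=> p_prime lt_rq; pose Mp : 'M['F_p]_(q, r) := map_mx intr M.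
have /rowV0Pn[c /sub_kermxP cM0 c_neq0] : kermx Mp != 0.
  by rewrite kermx_eq0 /row_free neq_ltn (leq_ltn_trans (rank_leq_col _) lt_rq).
exists c => //; set w := \sum_i _.
have p_dvd_w j : (p %| w ord0 j)%Z.
  rewrite (dvdz_pcharf (pchar_Fp p_prime)); apply/eqP.
  have /rowP/(_ j) := cM0; rewrite !mxE => <-; rewrite summxE rmorph_sum.
  by apply: eq_bigr => i _; rewrite mulmxnE !mxE rmorphMn /= -mulr_natl natr_Zp.
exists (\row_j (w ord0 j %/ p)%Z); apply/rowP => j.
by rewrite mulmxnE mxE -mulr_natr natz divzK.
Qed.

Lemma has_rank_dependent_mod (G : zmodType) (p r q : nat) (P : 'I_q -> G) :
    prime p -> has_rank G r -> (r < q)%N ->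
  exists2 c : 'rV['F_p]_q, c != 0 &
    exists y t N, [/\ \sum_i P i *+ c 0 i = y *+ p + t, (0 < N)%N & t *+ N = 0].
Proof.
move=> p_prime [T [f [g fK gK]]] lt_rq.
have [c c_neq0 [v cvE]] :=
  intmx_rows_dependent_mod (\matrix_i (f (P i)).2) p_prime lt_rq.
exists c => //; set x := \sum_i _.
have fx2 : (f x).2 = v *+ p.
  rewrite -cvE raddf_sum (big_morph snd (id1 := 0) (op1 := +%R)) //.
  by apply: eq_bigr => i _; rewrite raddfMn pairMnE rowK.
pose t := x - g (0, v) *+ p.
have ft : f t = ((f x).1, 0).
  rewrite raddfB raddfMn gK pairMnE mul0rn -fx2 /=.
  rewrite {1}[f x]surjective_pairing.
  by congr (_, _); rewrite /= ?subr0 ?subrr.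
exists (g (0, v)), t, #[(f x).1]%g.
split; [by rewrite addrC subrK | exact: order_gt0 | ].
apply: (can_inj fK); rewrite raddfMn raddf0 ft pairMnE mul0rn.
by rewrite -FinRing.zmodXgE expg_order.
Qed.

Definition divisible_mod_ptorsion (G : zmodType) (p : nat) (x : G) : Prop :=
  exists y t, x + t = y *+ p /\ t *+ p = 0.

Section NoOrderPrimeSquare.
Variables (G : zmodType) (p : nat).
Hypotheses (p_prime : prime p)
  (no_order_p2 : forall t : G, t *+ p *+ p = 0 -> t *+ p = 0).

Lemma p_power_torsion (e : nat) (t : G) : t *+ (p ^ e) = 0 -> t *+ p = 0.
Proof.
elim: e t => [|e IHe] t; first by rewrite mulr1n => ->; rewrite mul0rn.
by rewrite expnS mulrnA => /IHe; apply: no_order_p2.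
Qed.

Lemma torsion_divisible_mod_ptorsion (N : nat) (x : G) :
  (0 < N)%N -> x *+ N = 0 -> divisible_mod_ptorsion p x.
Proof.
move=> N_gt0 xN0.
have [M co_pM NE] := pfactor_coprime p_prime N_gt0.
have [[u v] /= bezout] := coprimezP p M co_pM.
exists (x *~ u), (- (x *~ (v * M%:Z))); split.
  by rewrite -{1}[x]mulr1z -bezout mulrzDr addrK mulrzA.
have xMp0 : x *+ M *+ p = 0.
  by apply: (@p_power_torsion (logn p N)); rewrite -mulrnA -NE.
by rewrite mulNrn [v * _]mulrC mulrzA pmulrn mulrzAC -!pmulrn xMp0 mul0rz oppr0.
Qed.

Lemma has_rank_divisible_mod_ptorsion (r q : nat) (P : 'I_q -> G) :
    has_rank G r -> (r < q)%N ->
  exists2 c : 'rV['F_p]_q, c != 0 &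
    divisible_mod_ptorsion p (\sum_i P i *+ c 0 i).
Proof.
move=> rank_r lt_rq.
have [c c_neq0 [y [t [N [sumE N_gt0 tN0]]]]] :=
  has_rank_dependent_mod P p_prime rank_r lt_rq.
have [z [s [tsE s_torsion]]] := torsion_divisible_mod_ptorsion N_gt0 tN0.
exists c => //; exists (y + z), s; split=> //.
by rewrite sumE -addrA tsE mulrnDl.
Qed.

End NoOrderPrimeSquare.

Lemma has_rank_lt2_divisible_mod_ptorsion (G : zmodType) (r : nat) (P Q : G) :
    (forall t : G, t *+ 2 *+ 2 = 0 -> t *+ 2 = 0) ->
    has_rank G r -> (r < 2)%N ->
  [\/ divisible_mod_ptorsion 2 P, divisible_mod_ptorsion 2 Q |
      divisible_mod_ptorsion 2 (P + Q)].
Proof.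
move=> no_order4 rank_r r_lt2; pose PQ (i : 'I_2) := if i == 0 then P else Q.
have [c /rV0Pn[i ci_neq0]] :=
  has_rank_divisible_mod_ptorsion (p := 2) isT no_order4 PQ rank_r r_lt2.
rewrite big_ord_recl big_ord1 {}/PQ /=.
have I2_cases (a : 'I_2) : a = ord0 \/ a = lift ord0 ord0.
  by case: a => [[|[|//]]] lta; [left | right]; apply: val_inj.
move: ci_neq0; case: (I2_cases i) => ->; case: (I2_cases (c 0 ord0)) => ->;
  case: (I2_cases (c 0 (lift ord0 ord0))) => -> //= _;
  rewrite ?mulr0n ?mulr1n ?add0r ?addr0;
  by [constructor 1 | constructor 2 | constructor 3].
Qed.

End RankModPrime.

Section TwoTorsion.
Local Open Scope ring_scope.
Variables (F : fieldType) (E : ellCurve F).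
Implicit Types (P Q T : ec_point E) (x y e : F).

Definition ec_root : pred F := fun e => e ^+ 3 + ec_a E * e + ec_b E == 0.

Lemma ec_rootP e : reflect (ec_b E = - (e ^+ 3 + ec_a E * e)) (ec_root e).
Proof.
apply: (iffP eqP) => [/eqP|->]; last by rewrite addrN.
by rewrite addrC addr_eq0 => /eqP.
Qed.

Lemma ec_coordD P Q : ec_coord (P + Q) = ec_add E (ec_coord P) (ec_coord Q).
Proof. by []. Qed.

Lemma two_torsion_coord T :
  T *+ 2 = 0 -> T = 0 \/ exists2 e, ec_coord T = Some (e, 0) & ec_root e.
Proof.
move/(congr1 (@ec_coord _ _)); rewrite mulr2n ec_coordD.
case coordT: (ec_coord T) => [[x y]|] /=; last by left; apply: val_inj.
rewrite eqxx /=; case: eqP => // y_eqN _; right.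
have y0 : y = 0.
  have /eqP : 2%:R * y = 0 by rewrite mulr_natl mulr2n {2}y_eqN subrr.
  by rewrite mulf_eq0 (negPf (ec_two_neq0 E)) => /eqP.
exists x; first by rewrite y0.
by have := ec_coordP T; rewrite coordT y0 /= expr0n eq_sym.
Qed.

Lemma double_sub_root_square Q x y e :
  ec_root e -> ec_coord (Q *+ 2) = Some (x, y) -> is_power 2 (x - e).
Proof.
move=> /ec_rootP bE; rewrite mulr2n ec_coordD; have := ec_coordP Q.
case: (ec_coord Q) => [[z w]|] //= /eqP wE.
rewrite eqxx /=; case: eqP => // w_neqN [<- _].
have w_neq0 : w != 0 by apply/eqP => w0; apply: w_neqN; rewrite w0 oppr0.
rewrite bE in wE.
exists (((z - e) ^+ 2 - (3%:R * e ^+ 2 + ec_a E)) / (2%:R * w)).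
rewrite /ec_slope eqxx; field: wE.
by rewrite w_neq0 ec_two_neq0.
Qed.

Lemma add_two_torsion_x P T x y e :
    ec_coord P = Some (x, y) -> ec_coord T = Some (e, 0) -> x != e ->
  exists y',
    ec_coord (P + T) = Some (e + (3%:R * e ^+ 2 + ec_a E) / (x - e), y').
Proof.
move=> coordP coordT x_neq_e; have := ec_coordP P; have := ec_coordP T.
rewrite ec_coordD coordP coordT /= (negPf x_neq_e) /= expr0n eq_sym.
move=> /ec_rootP bE /eqP yE; rewrite bE in yE.
have e_sub_x : e - x != 0 by rewrite subr_eq0 eq_sym.
eexists; congr (Some (_, _)); rewrite /ec_slope (negPf x_neq_e) sub0r.
by field: yE; rewrite subr_eq0 x_neq_e e_sub_x.
Qed.

End TwoTorsion.

Section CongruentCurve.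
Local Open Scope ring_scope.
Variables (A : nat) (A_gt0 : (0 < A)%N).
Local Notation C := (congruent_curve A A_gt0).
Implicit Types (P Q T : ec_point C) (x y e : rat).

Lemma congruent_rootE e :
  ec_root C e = [|| e == 0, e == A%:R | e == - A%:R].
Proof.
rewrite /ec_root /= -[e == A%:R]subr_eq0 -[e == - _]addr_eq0 -!mulf_eq0.
by congr (_ == _); ring.
Qed.

Lemma double_congruent_squares Q x y :
    ec_coord (Q *+ 2) = Some (x, y) ->
  [/\ is_power 2 x, is_power 2 (x - A%:R) & is_power 2 (x + A%:R)].
Proof.
move=> coord2Q; have sq := double_sub_root_square _ coord2Q.
by split; [rewrite -[x]subr0 | | rewrite -[A%:R]opprK]; apply: sq;
  rewrite congruent_rootE eqxx ?orbT.
Qed.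

Lemma congruent_no_order4 T : T *+ 2 *+ 2 = 0 -> T *+ 2 = 0.
Proof.
have A_rat_gt0 : 0 < A%:R :> rat by rewrite ltr0n.
case/two_torsion_coord => // -[e coord2T]; rewrite congruent_rootE => e_cases.
have [[b eE] [c e_subE] [d e_addE]] := double_congruent_squares coord2T.
have b2_ge0 := sqr_ge0 b; have c2_ge0 := sqr_ge0 c.
case/or3P: e_cases => /eqP e_eq; rewrite e_eq in eE e_subE e_addE;
  [by exfalso; lra | | by exfalso; lra].
have [s /esym] : is_power 2 2%N.
  apply: is_power_natr_rat; apply: (@is_power_mulXr _ _ _ b).
    by apply: contraTneq A_rat_gt0 => b0; rewrite eE b0 expr0n ltxx.
  by exists d; rewrite -eE -e_addE; ring.
by case: s => [|[|s]]; nia.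
Qed.

Lemma congruent_root_le e : ec_root C e -> e <= A%:R.
Proof.
have : 0 <= A%:R :> rat by rewrite ler0n.
by rewrite congruent_rootE => ? /or3P[] /eqP ->; lra.
Qed.

(* The points with [x > A] form the identity component of the real locus, so
   only the translation by [(A, 0)] keeps their abscissa nonnegative. *)
Lemma congruent_translate_ge0 x e :
    ec_root C e -> A%:R < x -> 0 <= e + (3%:R * e ^+ 2 + ec_a C) / (x - e) ->
  e = A%:R.
Proof.
move=> e_root lt_Ax; have A_rat_gt0 : 0 < A%:R :> rat by rewrite ltr0n.
have sub_gt0 : 0 < x - e.
  by rewrite subr_gt0 (le_lt_trans (congruent_root_le e_root)).
rewrite -(pmulr_lge0 _ sub_gt0) mulrDl divfK ?gt_eqF //=.
by move: e_root; rewrite congruent_rootE => /or3P[] /eqP -> //; nra.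
Qed.

Lemma congruent_divisible_squares P x y :
    ec_coord P = Some (x, y) -> A%:R < x -> divisible_mod_ptorsion 2 P ->
  is_power 2 (x - A%:R) /\ is_power 2 (x + A%:R) \/ is_power 2 (A%:R * x).
Proof.
move=> coordP lt_Ax [R [T [PT_eq T2]]].
have [T0|[e coordT e_root]] := two_torsion_coord T2.
  have : ec_coord (R *+ 2) = Some (x, y) by rewrite -PT_eq T0 addr0.
  by case/double_congruent_squares; left.
have x_neq_e : x != e.
  by rewrite gt_eqF ?(le_lt_trans (congruent_root_le e_root)).
have [y'] := add_two_torsion_x coordP coordT x_neq_e.
rewrite PT_eq => /double_congruent_squares[[b bE] [c cE] [d dE]].
have e_eqA : e = A%:R.
  by apply: (congruent_translate_ge0 e_root lt_Ax); rewrite bE sqr_ge0.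
rewrite {}e_eqA /= in x_neq_e cE dE.
have xA_neq0 : x - A%:R != 0 by rewrite subr_eq0.
have A_neq0 : A%:R != 0 :> rat by rewrite pnatr_eq0 -lt0n.
right; apply: (@is_power_mulXr _ _ _ (2%:R * A%:R / (x - A%:R))).
  by rewrite !mulf_neq0 ?invr_eq0.
by exists (c * d); rewrite [RHS]exprMn -cE -dE; field.
Qed.

End CongruentCurve.

(* Area of the right triangle with legs [u^2 - v^2] and [2 u v]; the truncated
   subtraction is only meant for [v <= u]. *)
Definition triangle_area (u v : nat) : nat := u * v * (u ^ 2 - v ^ 2).

Definition triangle_x (u v : nat) : rat :=
  (u%:R ^+ 2 * (u%:R ^+ 2 - v%:R ^+ 2))%R.

Definition triangle_y (u v : nat) : rat :=
  (u%:R ^+ 2 * (u%:R ^+ 2 - v%:R ^+ 2) ^+ 2)%R.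

Section TrianglePoint.
Local Open Scope ring_scope.
Variables (A : nat) (A_gt0 : (0 < A)%N) (u v : nat).
Hypotheses (lt_vu : (v < u)%N) (AE : A = triangle_area u v).
Local Notation C := (congruent_curve A A_gt0).

Lemma natr_triangle_area :
  A%:R = u%:R * v%:R * (u%:R ^+ 2 - v%:R ^+ 2) :> rat.
Proof. by rewrite AE /triangle_area !natrM natrB ?natrX // leq_sqr ltnW. Qed.

Lemma triangle_on_curve : on_curve C (Some (triangle_x u v, triangle_y u v)).
Proof.
by apply/eqP; rewrite /= natr_triangle_area /triangle_x /triangle_y; ring.
Qed.

Lemma natr_sqrB_gt0 : 0 < u%:R ^+ 2 - v%:R ^+ 2 :> rat.
Proof. by rewrite subr_gt0 -!natrX ltr_nat ltn_sqr. Qed.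

Lemma triangle_y_gt0 : 0 < triangle_y u v.
Proof.
by rewrite mulr_gt0 ?exprn_gt0 ?natr_sqrB_gt0 // ltr0n (leq_ltn_trans _ lt_vu).
Qed.

Lemma area_lt_triangle_x : A%:R < triangle_x u v.
Proof.
rewrite natr_triangle_area ltr_pM2r ?natr_sqrB_gt0 //.
rewrite expr2 ltr_pM2l ?ltr_nat //.
by rewrite ltr0n (leq_ltn_trans _ lt_vu).
Qed.

Lemma triangle_x_sub_area :
  triangle_x u v - A%:R = (u * (u + v))%:R * (u%:R - v%:R) ^+ 2.
Proof. by rewrite natr_triangle_area /triangle_x natrM natrD; ring. Qed.

Lemma triangle_x_add_area :
  triangle_x u v + A%:R = (u * (u - v))%:R * (u%:R + v%:R) ^+ 2.
Proof.
by rewrite natr_triangle_area /triangle_x natrM (natrB _ (ltnW lt_vu)); ring.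
Qed.

Lemma area_mul_triangle_x :
  A%:R * triangle_x u v = (u * v)%:R * (u%:R * (u%:R ^+ 2 - v%:R ^+ 2)) ^+ 2.
Proof. by rewrite natr_triangle_area /triangle_x natrM; ring. Qed.

Lemma triangle_divisible_squares (P : ec_point C) (y : rat) :
    coprime u v -> ec_coord P = Some (triangle_x u v, y) ->
    divisible_mod_ptorsion 2 P ->
  is_power 2 u /\
    (is_power 2 v \/ is_power 2 (u - v)%N /\ is_power 2 (u + v)%N).
Proof.
move=> co_uv coordP P_div.
have u_gt0 : (0 < u)%N := leq_ltn_trans (leq0n v) lt_vu.
have [[sub_sq add_sq]|mul_sq] :=
  congruent_divisible_squares coordP area_lt_triangle_x P_div.
  rewrite triangle_x_sub_area in sub_sq; rewrite triangle_x_add_area in add_sq.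
  have co_uDv : coprime u (u + v) by rewrite /coprime gcdnDl.
  have co_uBv : coprime u (u - v) by rewrite coprimenB // ltnW.
  have [|u_sq uDv_sq] := is_power_coprime_mul_rat co_uDv _ sub_sq.
    by rewrite subr_eq0 eqr_nat gtn_eqF.
  have [|_ uBv_sq] := is_power_coprime_mul_rat co_uBv _ add_sq.
    by rewrite -natrD pnatr_eq0 -lt0n addn_gt0 u_gt0.
  by split=> //; right.
rewrite area_mul_triangle_x in mul_sq.
have [|u_sq v_sq] := is_power_coprime_mul_rat co_uv _ mul_sq.
  by rewrite mulf_neq0 ?pnatr_eq0 -?lt0n // gt_eqF ?natr_sqrB_gt0.
by split=> //; left.
Qed.

End TrianglePoint.

Definition eisenstein_triple (m n l : nat) : Prop :=
  m ^ 2 = n ^ 2 + n * l + l ^ 2.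

Section EisensteinTriple.
Variables m n l : nat.
Hypothesis mnl_triple : eisenstein_triple m n l.

Lemma eisenstein_triple_sym : eisenstein_triple m l n.
Proof. by rewrite /eisenstein_triple mnl_triple; ring. Qed.

Lemma eisenstein_ltn : 0 < l -> n < m.
Proof. by move=> l_gt0; rewrite -ltn_sqr mnl_triple; nia. Qed.

Lemma eisenstein_ltn_add : 0 < n -> 0 < l -> m < n + l.
Proof. by move=> n_gt0 l_gt0; rewrite -ltn_sqr mnl_triple; nia. Qed.

Lemma eisenstein_odd : coprime n l -> odd m.
Proof.
move=> co_nl; have /negP : ~~ (2 %| gcdn n l) by rewrite (eqP co_nl).
have := congr1 odd mnl_triple.
rewrite dvdn_gcd !dvdn2 !oddD !oddX oddM /=.
by case: (odd m); case: (odd n); case: (odd l).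
Qed.

Lemma eisenstein_coprime_add : coprime n l -> coprime (n + l) m.
Proof.
move=> co_nl; rewrite -(@coprime_pexpr 2) // mnl_triple.
have -> : n ^ 2 + n * l + l ^ 2 = n * (n + l) + l ^ 2 by rewrite mulnDr mulnn.
rewrite /coprime gcdnMDl -/(coprime _ _) coprimeXr // coprime_sym.
by rewrite /coprime gcdnDr gcdnC.
Qed.

Lemma eisenstein_area_left : (n + l) * l * m * n = triangle_area m n.
Proof. by rewrite /triangle_area mnl_triple -addnA addKn; ring. Qed.

Lemma eisenstein_area_right : (n + l) * l * m * n = triangle_area m l.
Proof. by rewrite /triangle_area mnl_triple addnK; ring. Qed.

Lemma eisenstein_area_add : (n + l) * l * m * n = triangle_area (n + l) m.
Proof.
rewrite /triangle_area mnl_triple (_ : _ - _ = n * l); first by ring.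
by rewrite sqrnD; lia.
Qed.

End EisensteinTriple.

Lemma eisenstein_points_add (m n l : nat) (area_gt0 : 0 < (n + l) * l * m * n) :
    eisenstein_triple m n l -> 0 < n -> 0 < l ->
  ec_add (congruent_curve ((n + l) * l * m * n) area_gt0)
      (Some (triangle_x m n, triangle_y m n))
      (Some (triangle_x m l, triangle_y m l))
    = Some (triangle_x (n + l) m, - triangle_y (n + l) m)%R.
Proof.
move=> triple n_gt0 l_gt0.
have lt_nm := eisenstein_ltn triple l_gt0.
have lt_lm := eisenstein_ltn (eisenstein_triple_sym triple) n_gt0.
have areaE := natr_triangle_area lt_nm (eisenstein_area_left triple).
have mE : (m%:R ^+ 2 = n%:R ^+ 2 + n%:R * l%:R + l%:R ^+ 2 :> rat)%R.
  by rewrite -!natrX -natrM -!natrD -triple.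
rewrite (ec_add_slope (s := ((n + l)%:R ^+ 2)%R)).
- by congr (Some (_, _)); rewrite /triangle_x /triangle_y natrD; ring: mE.
- exact: triangle_on_curve lt_nm (eisenstein_area_left triple).
- exact: triangle_on_curve lt_lm (eisenstein_area_right triple).
- rewrite negb_and -addr_eq0 [X in _ || ~~ X]gt_eqF ?orbT //.
  by rewrite addr_gt0 ?triangle_y_gt0.
by split; rewrite /triangle_x /triangle_y /= ?areaE natrD; ring: mE.
Qed.

Theorem mainTheorem1 (m n l : nat)
    (m_gt0 : 0 < m) (n_gt0 : 0 < n) (l_gt0 : 0 < l)
    (coprime_mn : coprime m n) (coprime_ml : coprime m l)
    (coprime_nl : coprime n l)
    (j : nat) (p : 'I_j -> nat)
    (p_prime : forall i, prime (p i))
    (p_mod6 : forall i, p i = 1 %[mod 6])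
    (p_distinct : injective p)
    (m_prod : m = \prod_(i < j) p i)
    (m_sqr : m ^ 2 = n ^ 2 + n * l + l ^ 2) :
  let k := n + l in
  let A := k * l * m * n in
  let C_A := congruent_curve A (klmn_gt0 m_gt0 n_gt0 l_gt0) in
  forall r : nat, has_rank (ec_point C_A) r -> 2 <= r.
Proof.
move=> k A C_A r rank_r; rewrite leqNgt; apply/negP => r_lt2.
have lt_nm : n < m := eisenstein_ltn m_sqr l_gt0.
have lt_lm : l < m := eisenstein_ltn (eisenstein_triple_sym m_sqr) n_gt0.
have lt_mk : m < k := eisenstein_ltn_add m_sqr n_gt0 l_gt0.
have m_not_square : ~ is_power 2 m.
  rewrite m_prod; apply: prod_distinct_primes_not_power => //.
  by rewrite -m_prod (leq_ltn_trans n_gt0).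
have area_mn := eisenstein_area_left m_sqr.
have area_ml := eisenstein_area_right m_sqr.
have area_km := eisenstein_area_add m_sqr.
have co_km := eisenstein_coprime_add m_sqr coprime_nl.
pose P : ec_point C_A := EcPoint (triangle_on_curve _ lt_nm area_mn).
pose Q : ec_point C_A := EcPoint (triangle_on_curve _ lt_lm area_ml).
have coordP : ec_coord P = Some (triangle_x m n, triangle_y m n) := erefl.
have coordQ : ec_coord Q = Some (triangle_x m l, triangle_y m l) := erefl.
have coordPQ : ec_coord (P + Q)%R = Some (triangle_x k m, - triangle_y k m)%R.
  exact: eisenstein_points_add.
have [] := has_rank_lt2_divisible_mod_ptorsion P Q
  (@congruent_no_order4 _ _) rank_r r_lt2.
- by case/(triangle_divisible_squares lt_nm area_mn coprime_mn coordP).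
- by case/(triangle_divisible_squares lt_lm area_ml coprime_ml coordQ).
case/(triangle_divisible_squares lt_mk area_km co_km coordPQ) => k_sq.
case=> // -[kBm_sq kDm_sq].
have /(dvdn_trans (isT : 2 %| 4)) :=
  dvdn4_square_progression (ltnW lt_mk) kBm_sq k_sq kDm_sq.
by rewrite dvdn2 (eisenstein_odd m_sqr coprime_nl).
Qed.
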